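(* Let $F$ be a field, $n\ge 0$ an integer, and let $K=F(X_1,\ldots,X_n)^{\mathrm{sep}}$ be a separable closure of the rational function field $F(X_1,\ldots,X_n)$. Let $\mathbf{Com}$ denote the set of compact subgroups of the topological group $G_F(n)=\mathrm{Aut}_F(K)$, and let $\mathbf{Int}$ denote the set of subfields $E$ of $K$ containing $F$ such that the field extension $K/E$ is separable. Then the maps $$\mathbf{A}:\mathbf{Int}\to\mathbf{Com},\quad \mathbf{A}(E)=\mathrm{Aut}_E(K),\qquad \mathbf{F}:\mathbf{Com}\to\mathbf{Int},\quad \mathbf{F}(C)=K^C=\{y\in K: c(y)=y\text{ for all }c\in C\}$$ are (well defined and) mutually inverse, i.e. $\mathbf{A}\circ\mathbf{F}=\mathrm{id}_{\mathbf{Com}}$ and $\mathbf{F}\circ\mathbf{A}=\mathrm{id}_{\mathbf{Int}}$. Moreover, if $E\in\mathbf{Int}$, then $\mathbf{A}(E)$ is compact and open if and only if $E$ is finitely generated over $F$.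
   Context: ''Separable extension'' means separable algebraic extension. $G_F(n)=\mathrm{Aut}_F(K)$ is the group of all field automorphisms of $K$ fixing $F$ pointwise. Its topology is the unique group topology having as a base of neighborhoods of the identity the set of subgroups $\mathrm{Aut}_E(K)$, where $E$ runs over all subfields of $K$ such that $F\subseteq E$, $E$ is finitely generated (as a field) over $F$, and $K/E$ is a separable extension. On each such subgroup $\mathrm{Aut}_E(K)$ the induced topology is the Krull topology, and $G_F(n)$ is a totally disconnected locally compact group. *)

(* Defs.v *)
From HB Require Import structures.
From mathcomp Require Import all_boot all_order all_algebra all_field.
From mathcomp Require Import fraction generic_quotient.
From mathcomp Require mpoly.
From mathcomp Require Import all_classical topology.
(* The notations of mpoly.v clash with those of topology. *)
Export -(notations) mpoly.

Set Implicit Arguments.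
Unset Strict Implicit.
Unset Printing Implicit Defensive.

Import GRing.Theory.
Local Open Scope classical_set_scope.
Local Open Scope ring_scope.

Section Subfields.
Variable K : fieldType.
Implicit Types (E S : set K) (y : K) (p q : {poly K}).

Definition is_subfield E : Prop := GRing.divring_closed (mem E).

(* p is the minimal polynomial of y over E; divisibility of polynomials over E
   does not depend on the ambient field K. *)
Definition is_minpoly E y p : Prop :=
  [/\ p \is monic, p \is a polyOver (mem E), root p y
    & forall q, q \is a polyOver (mem E) -> root q y -> p %| q].

Definition separable_algebraic_elt E y : Prop :=
  exists2 p, is_minpoly E y p & separable_poly p.

(* The extension K/E is algebraic and separable. *)
Definition separable_under E : Prop := forall y, separable_algebraic_elt E y.

Definition separably_closed : Prop := forall p : {poly K},
  separable_poly p -> exists rs : seq K, p %= \prod_(z <- rs) ('X - z%:P).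

Definition subfield_gen S : set K := smallest is_subfield S.

Lemma subfield_gen_subfield S : is_subfield (subfield_gen S).
Proof.
split=> [|x y|x y]; rewrite !inE.
- by move=> A [[A1 _ _] _]; rewrite inE in A1.
- move=> hx hy A hA; have [[_ AB _] _] := hA.
  by have := AB x y; rewrite !inE; apply; [apply: hx|apply: hy].
- move=> hx hy A hA; have [[_ _ AD] _] := hA.
  by have := AD x y; rewrite !inE; apply; [apply: hx|apply: hy].
Qed.

Section MinPoly.
Variables (E : set K) (hE : is_subfield E).

Let S : divringClosed K :=
  HB.pack (mem E : {pred K}) (GRing.isDivringClosed.Build K (mem E) hE).

Lemma subfield_modp p q : p \is monic -> p \is a polyOver (mem E) ->
  q \is a polyOver (mem E) -> q %% p \is a polyOver (mem E).
Proof.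
move=> mp; rewrite -[mem E]/(mem S) => pE qE.
suff [d [r [_ rE dr sr]]] : exists d r, [/\ d \is a polyOver S,
    r \is a polyOver S, q = d * p + r & (size r < size p)%N].
  by rewrite dr modp_addl_mul_small.
have [m] := ubnP (size q); elim: m q qE => // m IHm q qE.
rewrite ltnS => sq.
have [sqp|spq] := ltnP (size q) (size p).
  by exists 0, q; rewrite rpred0 mul0r add0r.
have q0 : q != 0.
  by apply: contraTneq spq => ->; rewrite size_poly0 -ltnNge size_poly_gt0 monic_neq0.
pose c := lead_coef q *: 'X^(size q - size p)%N.
have cE : c \is a polyOver S.
  by rewrite polyOverZ ?rpredX ?polyOverX // (polyOverP qE).
have sq' : (size (q - c * p)%R < m)%N.
  have q1 : (0 < size q)%N by rewrite size_poly_gt0.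
  have p1 : (0 < size p)%N by rewrite size_poly_gt0 monic_neq0.
  rewrite -(prednK q1) in sq; apply: leq_ltn_trans sq; apply/leq_sizeP => j jq.
  rewrite coefB -scalerAl coefZ coefXnM ltnNge (leq_trans _ jq) /=; last first.
    by rewrite -subn1 leq_sub2l.
  move: jq; rewrite leq_eqVlt => /predU1P[<-|jq].
    have -> : ((size q).-1 - (size q - size p) = (size p).-1)%N.
      by rewrite -!subn1 subnAC subKn.
    rewrite -[p`__]/(lead_coef p) (monicP mp).
    by rewrite mulr1 subrr.
  rewrite prednK // in jq; rewrite [q`_j]nth_default // sub0r [p`__]nth_default.
    by rewrite mulr0 oppr0.
  by rewrite leq_subRL ?(leq_trans (leq_subr _ _) jq) // subnK.
have qE' : q - c * p \is a polyOver S by rewrite rpredB ?rpredM.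
have [d [r [dE rE dr sr]]] := IHm _ qE' sq'.
exists (c + d), r; split=> //; first by rewrite rpredD.
by rewrite mulrDl -addrA -dr addrC subrK.
Qed.


Lemma separable_algebraic_eltP y :
  (exists p, [/\ separable_poly p, p \is a polyOver (mem E) & root p y]) ->
  separable_algebraic_elt E y.
Proof.
move=> [p [sp pE py]]; have p0 := separable_poly_neq0 sp.
pose P m := `[< exists q, [/\ q != 0, q \is a polyOver (mem E), root q y
  & size q = m] >].
have exP : exists m, P m by exists (size p); apply/asboolP; exists p.
case: (ex_minnP exP) => m /asboolP[q [q0 qE qy <-]] qmin.
have lq0 : lead_coef q != 0 by rewrite lead_coef_eq0.
pose r := (lead_coef q)^-1 *: q.
have mr : r \is monic by rewrite monicE lead_coefZ mulVf.
have rE : r \is a polyOver (mem E).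
  have qS : q \is a polyOver S by [].
  by rewrite -[mem E]/(mem S) polyOverZ // rpredV (polyOverP qS).
have ry : root r y by rewrite rootZ // invr_eq0.
have rdvd u : u \is a polyOver (mem E) -> root u y -> r %| u.
  move=> uE uy; apply: contraT; rewrite /dvdp => ur0.
  have ur : (size (u %% r)%R < size q)%N.
    have: (size (u %% r)%R < size r)%N by rewrite ltn_modp monic_neq0.
    by rewrite size_scale // invr_eq0.
  have : P (size (u %% r)).
    apply/asboolP; exists (u %% r); split=> //; first exact: subfield_modp.
    move: uy; rewrite {1}(divp_eq u r) /root hornerD hornerM.
    by rewrite (rootP ry) mulr0 add0r.
  by move/qmin; rewrite leqNgt ur.
by exists r => //; apply: dvdp_separable sp; apply: rdvd.
Qed.


End MinPoly.

Lemma separable_underS E E' : is_subfield E' -> E `<=` E' ->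
  separable_under E -> separable_under E'.
Proof.
move=> hE' EE' sE y; have [p [_ pE py _] sp] := sE y.
apply: separable_algebraic_eltP => //; exists p; split=> //.
by apply/allP => c /(allP pE); rewrite !inE; apply: EE'.
Qed.

End Subfields.

Section Fractions.
Local Open Scope quotient_scope.

Lemma fraction_divE (R : idomainType) (x : {fraction R}) :
  exists a b : R, b != 0 /\ x = @tofrac R a / @tofrac R b.
Proof.
elim/quotW: x => r; exists (\n_r), (\d_r); split; first exact: denom_ratioP.
have db : @tofrac R (\d_r) != 0 by rewrite tofrac_eq0 denom_ratioP.
apply: (mulIf db); rewrite divfK //.
rewrite -[_ * _]/(FracField.mul _ _).
unlock tofrac; rewrite -FracField.pi_mul /FracField.mulf.
apply/eqmodP; rewrite /= FracField.equivfE.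
by rewrite !numden_Ratio ?oner_eq0 ?mulr1 ?mulf_neq0 ?denom_ratioP // mulrC.
Qed.

End Fractions.

(* A separable closure of L; L is identified with its image by sepC_emb. *)
Record sepClosure (L : fieldType) := SepClosure {
  sepC_field :> fieldType;
  sepC_emb : {rmorphism L -> sepC_field};
  sepC_separable : separable_under (range sepC_emb);
  sepC_closed : separably_closed sepC_field
}.

Notation ratfun F n := {fraction (mpoly n F)}.

Section Automorphisms.
Variables (F : fieldType) (n : nat) (K : sepClosure (ratfun F n)).

Definition base_emb : {rmorphism F -> K} :=
  sepC_emb K \o (@tofrac (mpoly n F) \o @mpolyC n F).

Definition base_field : set K := range base_emb.

Definition is_base_aut (f : K -> K) : Prop :=
  [/\ zmod_morphism f, monoid_morphism f, bijective f
    & forall a : F, f (base_emb a) = base_emb a].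

(* Aut_F(K); the product s * t is the composite s \o t. *)
Record baut := BAut { baut_fun :> K -> K; bautP : is_base_aut baut_fun }.

HB.instance Definition _ := gen_eqMixin baut.
HB.instance Definition _ := gen_choiceMixin baut.

Lemma baut_inj (s t : baut) : s =1 t -> s = t.
Proof.
case: s t => [f fP] [g gP] /= /funext fg; case: _ / fg gP => gP.
by rewrite (Prop_irrelevance fP gP).
Qed.


Lemma baut_zmod (s : baut) : zmod_morphism s.
Proof. by case: (bautP s). Qed.

Lemma baut_monoid (s : baut) : monoid_morphism s.
Proof. by case: (bautP s). Qed.

HB.instance Definition _ (s : baut) :=
  GRing.isZmodMorphism.Build K K s (baut_zmod s).
HB.instance Definition _ (s : baut) :=
  GRing.isMonoidMorphism.Build K K s (baut_monoid s).

Lemma baut_base (s : baut) a : s (base_emb a) = base_emb a.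
Proof. by case: (bautP s). Qed.

Lemma baut_one_subproof : is_base_aut id.
Proof. by split=> //; exists id. Qed.

Lemma baut_mul_subproof (s t : baut) : is_base_aut (s \o t).
Proof.
split; first by move=> x y; rewrite /= !rmorphB.
- by split=> [|x y] /=; rewrite ?rmorph1 ?rmorphM.
- by have [_ _ bs _] := bautP s; have [_ _ bt _] := bautP t; exact: bij_comp.
- by move=> a; rewrite /= !baut_base.
Qed.

Lemma baut_inv_subproof (s : baut) :
  exists t : baut, cancel s t /\ cancel t s.
Proof.
have [_ _ [t st ts] _] := bautP s.
suff tP : is_base_aut t by exists (BAut tP).
split; first by move=> x y; apply: (can_inj st); rewrite rmorphB /= !ts.
- by split=> [|x y]; apply: (can_inj st); rewrite ?rmorph1 ?rmorphM /= !ts.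
- exact: (Bijective ts st).
- by move=> a; apply: (can_inj st); rewrite ts baut_base.
Qed.

Definition baut_one : baut := BAut baut_one_subproof.
Definition baut_mul (s t : baut) : baut := BAut (baut_mul_subproof s t).
Definition baut_inv (s : baut) : baut := projT1 (cid (baut_inv_subproof s)).

Lemma baut_mulA : associative baut_mul.
Proof. by move=> s t u; apply: baut_inj. Qed.
Lemma baut_mul1 : left_id baut_one baut_mul.
Proof. by move=> s; apply: baut_inj. Qed.
Lemma baut_1mul : right_id baut_one baut_mul.
Proof. by move=> s; apply: baut_inj. Qed.
Lemma baut_mulV : left_inverse baut_one baut_inv baut_mul.
Proof.
move=> s; apply: baut_inj => x /=.
by rewrite /baut_inv; case: cid => t [/= + _]; apply.
Qed.
Lemma baut_Vmul : right_inverse baut_one baut_inv baut_mul.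
Proof.
move=> s; apply: baut_inj => x /=.
by rewrite /baut_inv; case: cid => t [/= _ +]; apply.
Qed.

HB.instance Definition _ := isGroup.Build baut
  baut_mulA baut_mul1 baut_1mul baut_mulV baut_Vmul.

Lemma baut1E x : (1%g : baut) x = x. Proof. by []. Qed.
Lemma bautME (s t : baut) x : (s * t)%g x = s (t x). Proof. by []. Qed.
Lemma bautKV (s : baut) : cancel s (s^-1)%g.
Proof. by move=> x; rewrite -bautME mulVg. Qed.
Lemma bautVK (s : baut) : cancel (s^-1)%g s.
Proof. by move=> x; rewrite -bautME mulgV. Qed.

Definition Int : set (set K) := [set E |
  [/\ is_subfield E, base_field `<=` E & separable_under E]].

Definition fin_gen (E : set K) : Prop :=
  exists s : seq K, E = subfield_gen (base_field `|` [set` s]).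

Definition Aut_over (E : set K) : set baut :=
  [set s : baut | forall y, E y -> s y = y].

Definition fixed_field (C : set baut) : set K :=
  [set y | forall c, C c -> c y = y].

(* Unions of left cosets of the subgroups Aut_over E, for E in Int finitely
   generated over the base field. By nbhs1_bautE, baut_mul_continuous and
   baut_inv_continuous below, this is the group topology for which these
   subgroups form a base of neighborhoods of 1. *)
Definition baut_open (U : set baut) : Prop := forall s, U s ->
  exists E, [/\ Int E, fin_gen E & [set (s * t)%g | t in Aut_over E] `<=` U].

Lemma ratfun_subfield (L : fieldType) (f : {rmorphism ratfun F n -> L})
    (E : set L) :
  is_subfield E ->
  (forall a : F, E (f (@tofrac (mpoly n F) (mpolyC n a)))) ->
  (forall i : 'I_n, E (f (@tofrac (mpoly n F) (@mpolyX n F (mnm1 i))))) ->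
  range f `<=` E.
Proof.
move=> hE fC fX.
pose S : divringClosed L :=
  HB.pack (mem E : {pred L}) (GRing.isDivringClosed.Build L (mem E) hE).
pose g : {rmorphism mpoly n F -> L} := f \o @tofrac (mpoly n F).
have gS p : g p \in S.
  rewrite (mpolyE p) rmorph_sum rpred_sum // => m _.
  rewrite -mul_mpolyC rmorphM rpredM //; first exact/mem_set/fC.
  rewrite mpolyXE_id rmorph_prod rpred_prod // => i _.
  by rewrite rmorphXn rpredX //; apply/mem_set/fX.
move=> _ [x _ <-]; have [a [b [_ ->]]] := fraction_divE x.
by apply: set_mem; rewrite fmorph_div -[mem E]/(mem S) rpred_div ?gS.
Qed.

Lemma Int_fin_gen_ex : exists E, Int E /\ fin_gen E.
Proof.
pose X i := sepC_emb K (@tofrac (mpoly n F) (@mpolyX n F (mnm1 i))).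
pose s := [seq X i | i <- enum 'I_n].
exists (subfield_gen (base_field `|` [set` s])); split; last by exists s.
have hE := subfield_gen_subfield (base_field `|` [set` s]).
split=> //; first by apply: subset_trans (@sub_gen_smallest _ _ _) => y; left.
apply: (separable_underS _ _ (@sepC_separable _ K)) => //.
apply: ratfun_subfield => // [a|i]; apply: sub_gen_smallest.
  by left; exists a.
by right; apply/mapP; exists i; rewrite ?mem_enum.
Qed.

Lemma Int_fin_gen_join E E' : Int E -> fin_gen E -> Int E' -> fin_gen E' ->
  exists E2, [/\ Int E2, fin_gen E2 & E `|` E' `<=` E2].
Proof.
move=> [_ _ sE] [s Es] _ [s' E's'].
pose E2 := subfield_gen (base_field `|` [set` s ++ s']).
have hE2 : is_subfield E2 by apply: subfield_gen_subfield.
have bE2 : base_field `|` [set` s ++ s'] `<=` E2 by apply: sub_gen_smallest.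
have EE2 : E `<=` E2.
  rewrite Es; apply: smallest_sub => //; apply: subset_trans bE2 => y.
  by case=> ?; [left|right; rewrite /= mem_cat; apply/orP; left].
have E'E2 : E' `<=` E2.
  rewrite E's'; apply: smallest_sub => //; apply: subset_trans bE2 => y.
  by case=> ?; [left|right; rewrite /= mem_cat; apply/orP; right].
exists E2; split; [|by exists (s ++ s')|by rewrite subUset].
split=> //; last exact: (separable_underS _ _ sE).
by apply: subset_trans bE2 => y; left.
Qed.

Lemma Aut_overS E E' : E `<=` E' -> Aut_over E' `<=` Aut_over E.
Proof. by move=> EE' s hs y /EE'; apply: hs. Qed.

Lemma Aut_over_group E : group_closed (mem (Aut_over E)).
Proof.
split=> [|s t]; rewrite !inE // => hs ht y Ey.
by rewrite bautME hs // -{1}(ht y Ey) bautKV.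
Qed.

Lemma baut_openT : baut_open setT.
Proof. by move=> s _; have [E [? ?]] := Int_fin_gen_ex; exists E. Qed.

Lemma baut_openI : setI_closed baut_open.
Proof.
move=> U V hU hV s [/hU [E [IE fE sU]] /hV [E' [IE' fE' sV]]].
have [E2 [IE2 fE2]] := Int_fin_gen_join IE fE IE' fE'.
rewrite subUset => -[EE2 E'E2]; exists E2; split=> //.
move=> _ [t ht <-]; split; [apply: sU|apply: sV]; exists t => //.
  exact: Aut_overS ht.
exact: Aut_overS ht.
Qed.

Lemma baut_open_bigU (I : Type) (f : I -> set baut) :
  (forall i, baut_open (f i)) -> baut_open (\bigcup_i f i).
Proof.
move=> hf s [i _ /hf [E [IE fE sU]]]; exists E; split=> // t /sU fit.
by exists i.
Qed.

HB.instance Definition _ := isOpenTopological.Build baut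
  baut_openT baut_openI baut_open_bigU.

Lemma nbhs_bautE (s : baut) (U : set baut) : nbhs s U <->
  exists E, [/\ Int E, fin_gen E & [set (s * t)%g | t in Aut_over E] `<=` U].
Proof.
split=> [[V [hV Vs VU]]|[E [IE fE sU]]].
  have [E [IE fE sV]] := hV s Vs; exists E; split=> //.
  exact: subset_trans VU.
exists [set (s * t)%g | t in Aut_over E]; split=> //.
  move=> _ [t ht <-]; exists E; split=> // _ [u hu <-].
  exists (t * u)%g; last by rewrite mulgA.
  by move=> y Ey; rewrite bautME hu ?ht.
by exists 1%g => //; rewrite mulg1.
Qed.

Lemma nbhs1_bautE (U : set baut) : nbhs (1%g : baut) U <->
  exists E, [/\ Int E, fin_gen E & Aut_over E `<=` U].
Proof.
rewrite nbhs_bautE; split=> -[E [IE fE sU]]; exists E; split=> //.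
  by move=> t ht; apply: sU; exists t => //; rewrite mul1g.
by move=> _ [t ht <-]; rewrite mul1g; apply: sU.
Qed.

Lemma image_subfield (s : baut) E : is_subfield E -> is_subfield (s @` E).
Proof.
move=> [E1 EB ED]; split=> [|x y|x y]; rewrite !inE.
- by exists 1; [exact: set_mem|rewrite rmorph1].
- move=> [x' x'E <-] [y' y'E <-]; exists (x' - y'); last by rewrite rmorphB.
  by apply/set_mem/EB; apply: mem_set.
- move=> [x' x'E <-] [y' y'E <-]; exists (x' / y'); last by rewrite fmorph_div.
  by apply/set_mem/ED; apply: mem_set.
Qed.

Lemma image_Int (s : baut) E : Int E -> Int (s @` E).
Proof.
move=> [hE bE sE]; split; first exact: image_subfield.
  by move=> _ [a _ <-]; exists (base_emb a); rewrite ?baut_base //; apply: bE; exists a.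
move=> y; have [p [_ pE py _] sp] := sE ((s^-1)%g y).
apply: separable_algebraic_eltP; first exact: image_subfield.
exists (map_poly s p); split.
- by rewrite separable_map.
- apply/(all_nthP 0) => i; rewrite size_map_poly => ip.
  rewrite coef_map inE; exists p`_i => //.
  by apply: set_mem; apply: (all_nthP 0 pE).
- by rewrite -(bautVK s y) fmorph_root.
Qed.

Lemma image_subfield_gen (s : baut) A :
  s @` subfield_gen A `<=` subfield_gen (s @` A).
Proof.
move=> _ [x xA <-] B [hB AB].
have : ((s^-1)%g @` B) x.
  apply: xA; split; first exact: image_subfield.
  by move=> z Az; exists (s z); rewrite ?bautKV //; apply: AB; exists z.
by case=> z Bz <-; rewrite bautVK.
Qed.

Lemma image_fin_gen (s : baut) E : fin_gen E -> fin_gen (s @` E).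
Proof.
move=> [r ->]; exists (map s r).
have eqA : s @` (base_field `|` [set` r]) = base_field `|` [set` map s r].
  apply/seteqP; split=> [_ [y [[a _ <-]|yr] <-]|y [[a _ <-]|/mapP[z zr ->]]].
  - by left; exists a; rewrite ?baut_base.
  - by right; rewrite /= map_f.
  - by exists (base_emb a); rewrite ?baut_base //; left; exists a.
  - by exists z => //; right.
rewrite -eqA; apply/seteqP; split; first exact: image_subfield_gen.
apply: smallest_sub; first exact/image_subfield/subfield_gen_subfield.
by apply: image_subset; apply: sub_gen_smallest.
Qed.

Lemma baut_mul_continuous :
  continuous (fun st : baut * baut => (st.1 * st.2)%g).
Proof.
move=> [s t] U /nbhs_bautE [E [IE fE sU]].
exists ([set (s * u)%g | u in Aut_over (t @` E)],
        [set (t * u)%g | u in Aut_over E]) => /=.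
  split; apply/nbhs_bautE; last by exists E; split.
  by exists (t @` E); split; [exact: image_Int|exact: image_fin_gen|].
move=> [_ _] /= [[u hu <-] [v hv <-]]; apply: sU.
exists (t^-1 * u * t * v)%g; last by rewrite !mulgA mulgK.
move=> y Ey; rewrite !bautME hv // hu ?bautKV //.
Qed.

Lemma baut_inv_continuous : continuous (fun s : baut => (s^-1)%g).
Proof.
move=> s U /nbhs_bautE [E [IE fE sU]].
apply/nbhs_bautE; exists ((s^-1)%g @` E); split.
- exact: image_Int.
- exact: image_fin_gen.
move=> _ [u hu <-]; apply: sU; exists (s * u^-1 * s^-1)%g.
  move=> y Ey; rewrite !bautME.
  have hy : u ((s^-1)%g y) = (s^-1)%g y by apply: hu; exists y.
  by rewrite -{1}hy bautKV bautVK.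
by rewrite invgM !mulgA mulVg mul1g.
Qed.

Definition Com : set (set baut) :=
  [set C : set baut | group_closed (mem C) /\ compact C].

End Automorphisms.

Arguments Int {F n} K _.
Arguments Com {F n} K _.

(* Main.v *)
(* For E in Int every automorphism over E permutes the finitely many roots
   of each separable polynomial over E, so an ultrafilter on Aut_E(K)
   converges pointwise, and its limit is again an automorphism: Aut_E(K) is
   compact.  Zorn's lemma, applied to the graphs of isomorphisms between
   subfields of K, extends the E-embeddings of E(y); hence the fixed field of
   Aut_E(K) is E.

   Conversely let C be compact.  Orbits of C are finite since evaluation is
   locally constant, and the orbit polynomial of y shows that y is separable over
   K^C.  A finite tuple is encoded as a polynomial u in K[T]; its orbit polynomial
   in K[T][Z] has coefficients fixed by C, hence by Aut_(K^C)(K), so every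
   automorphism over K^C agrees with some element of C on the tuple.  Therefore C
   is dense in Aut_(K^C)(K), and closed.

   If Aut_E(K) is open, it contains some Aut_E'(K) with E' finitely generated, so
   E is contained in E'.  Let E0 be generated over F by the coefficients of
   polynomials over E annihilating the generators of E'.  Then E' lies in a
   finite-dimensional E0-space, and so does E, which is thus finitely
   generated. *)
From HB Require Import structures.
Require Import Defs.
From mathcomp Require Import all_boot all_order all_algebra all_field.
From mathcomp Require Import fraction all_classical topology.

Set Implicit Arguments.
Unset Strict Implicit.
Unset Printing Implicit Defensive.

Import GRing.Theory.
Local Open Scope classical_set_scope.
Local Open Scope ring_scope.

(** * Closure properties of subfields *)

Section Subfields.
Variable K : fieldType.
Implicit Types E : set K.

Lemma subfieldB E u v : is_subfield E -> E u -> E v -> E (u - v).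
Proof. by case=> _ EB _ Eu Ev; apply/set_mem/EB; apply: mem_set. Qed.

Lemma subfield_div E u v : is_subfield E -> E u -> E v -> E (u / v).
Proof. by case=> _ _ ED Eu Ev; apply/set_mem/ED; apply: mem_set. Qed.

Lemma subfield1 E : is_subfield E -> E 1.
Proof. by case=> E1 _ _; apply: set_mem. Qed.

Lemma subfield0 E : is_subfield E -> E 0.
Proof.
by move=> hE; rewrite -(subrr 1); apply: (subfieldB hE); apply: subfield1.
Qed.

Lemma subfieldD E u v : is_subfield E -> E u -> E v -> E (u + v).
Proof.
move=> hE Eu Ev; rewrite -[v]opprK -[- v]sub0r.
by apply: subfieldB Eu _ => //; apply: subfieldB Ev => //; apply: subfield0.
Qed.

Lemma subfieldM E u v : is_subfield E -> E u -> E v -> E (u * v).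
Proof.
move=> hE Eu Ev; rewrite -[v]invrK -[v^-1]div1r.
by apply: subfield_div Eu _ => //; apply: subfield_div Ev => //; apply: subfield1.
Qed.

End Subfields.

(* The graph of an isomorphism between two subfields of K. *)
Definition partial_iso (K : fieldType) (A : set (K * K)) : Prop :=
  [/\ A 1, forall u v, A u -> A v -> A (u - v),
      forall u v, A u -> A v -> A (u * v),
      forall u, A u -> A (u.1^-1, u.2^-1) & forall b, A (0, b) -> b = 0].

(** * The graph of a partial isomorphism as a field *)

Section GraphField.
Variables (K : fieldType) (A : set (K * K)) (hA : partial_iso A).

Lemma graph_subring_closed : GRing.subring_closed (mem A).
Proof.
case: hA => A1 AB AM _ _.
by split=> [|u v|u v]; rewrite !inE; [|exact: AB|exact: AM].
Qed.

(* The dependency on hA lets the ring structure be inferred. *)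
Definition graph_pred : {pred K * K} := let _ := hA in mem A.

HB.instance Definition _ :=
  GRing.isSubringClosed.Build (K * K)%type graph_pred graph_subring_closed.

Definition graph_field := {u : K * K | in_mem u (mem graph_pred)}.

HB.instance Definition _ := [isSub of graph_field for @sval _ _].
HB.instance Definition _ := [Choice of graph_field by <:].
HB.instance Definition _ := [SubChoice_isSubComNzRing of graph_field by <:].

Lemma graph_inv_subproof (u : graph_field) :
  ((val u).1^-1, (val u).2^-1) \in graph_pred.
Proof. by case: hA => _ _ _ AV _; rewrite inE; apply/AV/set_mem/(valP u). Qed.

Definition graph_inv (u : graph_field) : graph_field :=
  exist [eta in_mem^~ (mem graph_pred)] _ (graph_inv_subproof u).

Lemma graph_mulVf (u : graph_field) : u != 0 -> graph_inv u * u = 1.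
Proof.
case: hA => A1 AB AM AV A0 u0; have Au : A (val u) by apply/set_mem/(valP u).
have u1 : (val u).1 != 0.
  apply: contra u0 => /eqP u10; apply/eqP/val_inj.
  by case: (val u) Au u10 => a b /= + a0; rewrite a0 => /A0 ->.
(* A pair (a, 0) with a nonzero would put (1, 0), hence (0, 1) = (1, 1) - (1, 0), in the graph. *)
have u2 : (val u).2 != 0.
  apply: contraNneq u1 => u20; have := AM _ _ (AV _ Au) Au.
  case: (val u) Au u20 => a b /= Aab b0; rewrite b0.
  have [-> //|a0] := eqVneq a 0.
  rewrite -[(a^-1, _) * _]/(a^-1 * a, 0^-1 * 0) mulr0 mulVf // => A10.
  have := AB _ _ A1 A10; rewrite -[1 - _]/(1 - 1, 1 - 0) subrr subr0 => /A0/eqP.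
  by rewrite oner_eq0.
apply: val_inj; rewrite rmorphM rmorph1.
rewrite -[LHS]/((val u).1^-1 * (val u).1, (val u).2^-1 * (val u).2).
by rewrite !mulVf.
Qed.

Lemma graph_inv0 : graph_inv 0 = 0.
Proof. by apply: val_inj; rewrite /= /graph_inv /= !invr0. Qed.

HB.instance Definition _ :=
  GRing.ComNzRing_isField.Build graph_field graph_mulVf graph_inv0.

End GraphField.

(** * Minimal polynomials and simple extensions *)

Section PartialIso.
Variable K : fieldType.
Implicit Types (L : fieldType) (A : set (K * K)) (E : set K).

(** Turns the domain into a field type [L] with two embeddings in [K], so that division and gcd in
    [{poly L}] become available. *)
Lemma partial_iso_range A : partial_iso A ->
  exists (L : fieldType) (i f : {rmorphism L -> K}),
    A = range (fun l => (i l, f l)).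
Proof.
move=> hA; exists (graph_field hA).
exists (fst \o val : {rmorphism graph_field hA -> K}).
exists (snd \o val : {rmorphism graph_field hA -> K}).
apply/seteqP; split=> [u Au|_ [l _ <-]] /=.
  have uA : u \in graph_pred hA by rewrite inE.
  by exists (exist _ u uA : graph_field hA) => //=; case: u {Au uA}.
by case: l => -[a b] /= /set_mem.
Qed.

Lemma subfield_range E : is_subfield E ->
  exists (L : fieldType) (i : {rmorphism L -> K}), E = range i.
Proof.
move=> hE; have [|L [i [f]]] := @partial_iso_range [set (e, e) | e in E].
  split.
  - by exists 1; first exact: subfield1.
  - by move=> _ _ [a Ea <-] [b Eb <-]; exists (a - b); first exact: subfieldB.
  - by move=> _ _ [a Ea <-] [b Eb <-]; exists (a * b); first exact: subfieldM.
  - move=> _ [a Ea <-]; exists (a^-1) => //; rewrite -div1r.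
    by apply: (subfield_div hE) => //; apply: subfield1.
  - by move=> _ [_ _ [-> <-]].
move=> /seteqP[diagL Ldiag]; exists L, i; apply/seteqP; split=> [e Ee|_ [l _ <-]].
  by have [|l _ [il _]] := diagL (e, e); [exists e|exists l].
by have [|e Ee [<- _]] := Ldiag (i l, f l); first exists l.
Qed.

Lemma minimal_annihilator L (i : {rmorphism L -> K}) x (q : {poly L}) :
  q != 0 -> root (map_poly i q) x ->
  exists m, [/\ m != 0, root (map_poly i m) x
    & forall p, root (map_poly i p) x -> m %| p].
Proof.
move=> q0 qx; pose P k := `[< exists m : {poly L},
  [/\ m != 0, root (map_poly i m) x & size m = k] >].
have exP : exists k, P k by exists (size q); apply/asboolP; exists q.
case: (ex_minnP exP) => k /asboolP[m [m0 mx <-]] mmin.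
exists m; split=> // p px; apply: contraT; rewrite /dvdp => r0.
have := ltn_modp p m; rewrite m0 ltnNge mmin //; apply/asboolP.
exists (p %% m); split=> //.
move: px; rewrite {1}(divp_eq p m) rmorphD rmorphM /root hornerD hornerM.
by rewrite (rootP mx) mulr0 add0r.
Qed.

(** Sending x to x' is well defined because [m] divides every polynomial annihilating x. Inverses
    come from a Bezout relation with [m], evaluated at both roots. *)
Lemma simple_extension L (i f : {rmorphism L -> K}) (m : {poly L}) x x' :
  m != 0 -> root (map_poly i m) x ->
  (forall p, root (map_poly i p) x -> m %| p) -> root (map_poly f m) x' ->
  partial_iso (range (fun p => ((map_poly i p).[x], (map_poly f p).[x']))).
Proof.
move=> m0 mx mmin mx'.
have root_f p : root (map_poly i p) x -> root (map_poly f p) x'.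
  move=> /mmin; rewrite -(dvdp_map f) => /dvdpP[q ->].
  by rewrite rootM mx' orbT.
split.
- by exists 1 => //; rewrite !rmorph1 !hornerC.
- move=> _ _ [p _ <-] [q _ <-]; exists (p - q) => //.
  by rewrite !rmorphB !hornerD !hornerN.
- by move=> _ _ [p _ <-] [q _ <-]; exists (p * q) => //; rewrite !rmorphM !hornerM.
(* If p vanishes at x, both values are 0 and 0^-1 = 0, so the zero polynomial serves. *)
- move=> _ [p _ <-] /=; have [px|px] := boolP (root (map_poly i p) x).
    rewrite (rootP px) (rootP (root_f _ px)) invr0.
    by exists 0 => //; rewrite !rmorph0 !horner0.
  have cpm : coprimep p m.
    (* In m = e * gcd(p, m) one factor annihilates x. If it is e, then [m] divides e and the gcd is
       constant; it cannot be the gcd, which divides p. *)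
    rewrite /coprimep; have /dvdpP[e me] := dvdp_gcdr p m.
    have : root (map_poly i m) x by [].
    have e0 : e != 0 by apply: contraNneq m0 => e0; rewrite me e0 mul0r.
    have d0 : gcdp p m != 0 by rewrite gcdp_eq0 negb_and m0 orbT.
    rewrite {1}me rmorphM rootM => /orP[/mmin|dx].
      have sd : (0 < size (gcdp p m))%N by rewrite size_poly_gt0.
      move=> /(dvdp_leq e0); rewrite {1}me size_mul // -(prednK sd) addnS /=.
      by rewrite -[leqRHS]addn0 leq_add2l leqn0.
    have /dvdpP[d pd] := dvdp_gcdl p m.
    by move: px; rewrite pd rmorphM rootM dx orbT.
  have /Bezout_eq1_coprimepP[[u v] /= uv] := cpm.
  have uV (g : {rmorphism L -> K}) z : root (map_poly g m) z ->
      (map_poly g u).[z] = (map_poly g p).[z]^-1.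
    move=> mz; have /(congr1 (fun p => (map_poly g p).[z])) := uv.
    rewrite rmorphD !rmorphM rmorph1 hornerD !hornerM (rootP mz) mulr0 addr0.
    rewrite hornerC => upz; rewrite -[RHS]mul1r -upz mulfK //.
    by apply: contra_eq_neq upz => ->; rewrite mulr0 eq_sym oner_eq0.
  by exists u => //; rewrite !uV.
- by move=> _ [p _ [/rootP/root_f/rootP-> <-]].
Qed.

Lemma polyOver_lift L (i f : {rmorphism L -> K}) E p :
  (forall e, E e -> exists l, i l = e /\ f l = e) ->
  p \is a polyOver (mem E) ->
  exists q, map_poly i q = p /\ map_poly f q = p.
Proof.
move=> Eif pE.
have /choice[c cP] : forall e, exists l, E e -> i l = e /\ f l = e.
  move=> e; have [/Eif[l hl]|nE] := pselect (E e); first by exists l.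
  by exists 0.
have pEk k : (k < size p)%N -> E p`_k.
  by move=> kp; apply: set_mem; apply: (allP pE); apply: mem_nth.
exists (\poly_(k < size p) c p`_k).
split; apply/polyP => k; rewrite coef_map coef_poly; case: ltnP => kp.
- by case: (cP _ (pEk _ kp)).
- by rewrite raddf0 nth_default.
- by case: (cP _ (pEk _ kp)).
- by rewrite raddf0 nth_default.
Qed.

Lemma map_poly_fixed (g : {rmorphism K -> K}) E p :
  (forall e, E e -> g e = e) -> p \is a polyOver (mem E) -> map_poly g p = p.
Proof.
move=> gE pE; apply/polyP => k; rewrite coef_map /=.
have [kp|kp] := ltnP k (size p); last by rewrite nth_default // raddf0.
by apply/gE/set_mem/(allP pE)/mem_nth.
Qed.

End PartialIso.

(** * Extending partial isomorphisms to all of [K] *)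

Section Extension.
Variables (K : fieldType) (E : set K).
Hypotheses (sepE : separable_under E) (closedK : separably_closed K).
Implicit Types (A : set (K * K)).

Lemma conjugates y : exists (p : {poly K}) (rs : seq K),
  [/\ p \is a polyOver (mem E), uniq rs, root p y
    & p %= \prod_(z <- rs) ('X - z%:P)].
Proof.
have [p [_ pE py _] sp] := sepE y; have [rs prs] := closedK sp.
exists p, rs; split=> //.
by rewrite -separable_prod_XsubC -(eqp_separable prs).
Qed.

(** The minimal polynomial m of x over the domain divides a polynomial over [E] that splits in [K].
    The isomorphism fixes the latter, so the image of m divides it too and has a root x' in [K]. *)
Lemma partial_iso_extend A x : partial_iso A -> (forall e, E e -> A (e, e)) ->
  exists A', [/\ partial_iso A', A `<=` A' & exists x', A' (x, x')].
Proof.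
move=> /partial_iso_range[L [i [f ->]]] EA.
have [p [rs [pE _ px prs]]] := conjugates x.
have [q [qp qp']] : exists q, map_poly i q = p /\ map_poly f q = p.
  by apply: (polyOver_lift _ pE) => e /EA[l _ [il fl]]; exists l.
have q0 : q != 0.
  rewrite -(map_poly_eq0 i) qp -size_poly_eq0 (eqp_size prs).
  by rewrite size_prod_XsubC.
have qx : root (map_poly i q) x by rewrite qp.
have [m [m0 mx mmin]] := minimal_annihilator q0 qx.
have [x' mx'] : exists x', root (map_poly f m) x'.
  have [|mk mrs] := @dvdp_prod_XsubC _ _ rs id (map_poly f m).
    by rewrite -(eqp_dvdr _ prs) -qp' dvdp_map mmin.
  have : (1 < size (map_poly i m))%N.
    by apply: root_size_gt1 mx; rewrite map_poly_eq0.
  rewrite size_map_poly -(size_map_poly f) (eqp_size mrs) size_prod_XsubC.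
  case: (mask mk rs) mrs => // x' s mrs _; exists x'.
  by rewrite (eqp_root mrs) root_prod_XsubC mem_head.
exists (range (fun p => ((map_poly i p).[x], (map_poly f p).[x']))); split.
- exact: simple_extension mx'.
- move=> _ [l _ <-]; exists l%:P => //.
  by rewrite !map_polyC !hornerC.
- by exists x', 'X => //; rewrite !map_polyX !hornerX.
Qed.

Lemma maximal_partial_iso A0 : partial_iso A0 ->
  exists A, [/\ partial_iso A, A0 `<=` A
    & forall B, partial_iso B -> A `<=` B -> B `<=` A].
Proof.
(* The empty set is allowed because Zorn_bigcup also considers empty chains. *)
move=> hA0; pose P A := A = set0 \/ partial_iso A /\ A0 `<=` A.
have [C CP Ctot|A [PA Amax]] := @Zorn_bigcup _ P.
  have [C0|] := pselect (forall X, C X -> X = set0).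
    by left; apply/seteqP; split=> // u [X /C0-> ].
  move=> /existsNP[X /not_implyP[CX X0]]; right.
  have hX Y u : C Y -> Y u -> partial_iso Y /\ A0 `<=` Y.
    by move=> CY Yu; case: (CP _ CY) => // Y0; rewrite Y0 in Yu.
  have [u Xu] : X !=set0 by apply/set0P/eqP.
  (* Since [C] is a chain, each closure property of the union can be checked in a single member. *)
  have two v w : (\bigcup_(Y in C) Y) v -> (\bigcup_(Y in C) Y) w ->
      exists Y, [/\ C Y, Y v, Y w & partial_iso Y].
    move=> [Y CY Yv] [Z CZ Zw]; have [YZ|ZY] := Ctot _ _ CY CZ.
      by exists Z; split=> //; [exact: YZ|case: (hX _ _ CZ Zw)].
    by exists Y; split=> //; [exact: ZY|case: (hX _ _ CY Yv)].
  split; last by move=> v A0v; exists X => //; apply: (hX _ _ CX Xu).2.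
  split.
  - by exists X => //; case: (hX _ _ CX Xu) => -[].
  - by move=> v w /two/[apply] -[Y [CY Yv Yw [_ YB _ _ _]]]; exists Y => //; exact: YB.
  - by move=> v w /two/[apply] -[Y [CY Yv Yw [_ _ YM _ _]]]; exists Y => //; exact: YM.
  - move=> v [Y CY Yv]; exists Y => //; case: (hX _ _ CY Yv).
    by move=> -[_ _ _ YV _] _; exact: YV.
  - by move=> b [Y CY Yb]; case: (hX _ _ CY Yb) => -[_ _ _ _ Y0] _; exact: Y0.
have [A0e|[hA A0A]] := PA.
  have PA0 : P A0 by right; split.
  suff AA0 : A `<` A0 by case: (Amax A0 AA0 PA0).
  rewrite A0e; split=> // A00; have [A01 _ _ _ _] := hA0.
  exact: A00 A01.
exists A; split=> // B hB AB; apply: contrapT => nBA.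
have PB : P B by right; split=> //; apply: subset_trans AB.
by case: (Amax B).
Qed.

(** By [partial_iso_extend] a maximal graph has domain [K]; its last clause makes it
    single-valued. *)
Lemma extend_to_endo A0 : partial_iso A0 -> (forall e, E e -> A0 (e, e)) ->
  exists g : K -> K, [/\ zmod_morphism g, monoid_morphism g
    & forall a b, A0 (a, b) -> g a = b].
Proof.
move=> hA0 EA0; have [A [hA A0A Amax]] := maximal_partial_iso hA0.
have /choice[g gA] : forall x, exists y, A (x, y).
  move=> x; have [|A' [hA' AA' [x' A'x]]] := @partial_iso_extend A x hA.
    by move=> e /EA0; exact: A0A.
  by exists x'; apply: (Amax A').
have [A1 AB AM _ Az] := hA.
have gE a b : A (a, b) -> g a = b.
  move=> Aab; apply/eqP; rewrite -subr_eq0; apply/eqP/Az.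
  by have := AB _ _ (gA a) Aab; rewrite -[_ - _]/(a - a, g a - b) subrr.
exists g; split; last by move=> a b /A0A/gE.
- by move=> x y; apply: gE; apply: (AB _ _ (gA x) (gA y)).
- by split=> [|x y]; apply: gE => //; apply: (AM _ _ (gA x) (gA y)).
Qed.

(** An injective map permutes the finite set of roots of a polynomial that it fixes, so every y
    algebraic over [E] is in the image. *)
Lemma endo_bijective (g : {rmorphism K -> K}) :
  (forall e, E e -> g e = e) -> bijective g.
Proof.
move=> gE; have gsurj y : exists x, g x = y.
  have [p [rs [pE urs py prs]]] := conjugates y.
  have root_prs z : root p z = (z \in rs).
    by rewrite (eqp_root prs) root_prod_XsubC.
  have gp : map_poly g p = p by apply: map_poly_fixed pE.
  have urs' : uniq (map g rs) by rewrite map_inj_uniq //; exact: fmorph_inj.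
  have sub : {subset map g rs <= rs}.
    move=> _ /mapP[z + ->].
    by rewrite -!root_prs -{2}gp fmorph_root.
  have [_ eqrs] := uniq_min_size urs' sub (eq_leq (esym (size_map _ _))).
  have : y \in map g rs by rewrite eqrs -root_prs.
  by case/mapP => x _ ->; exists x.
have [h hK] := choice gsurj.
by exists h => // x; apply: (fmorph_inj g); rewrite hK.
Qed.

(** The minimal polynomial of y over [E] splits with simple roots. A second root z exists, since
    otherwise it is linear and y lies in [E]; the map sending y to z then extends to [K]. *)
Lemma exists_moving_endo y : is_subfield E -> ~ E y ->
  exists g : K -> K, [/\ zmod_morphism g, monoid_morphism g,
    forall e, E e -> g e = e & g y <> y].
Proof.
move=> hE nEy; have [L [i Ei]] := subfield_range hE.
have iE e : E e -> exists l, i l = e /\ i l = e.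
  by rewrite Ei => -[l _ il]; exists l.
have [p [rs [pE urs py prs]]] := conjugates y.
have [q [qp _]] := polyOver_lift iE pE.
have q0 : q != 0.
  rewrite -(map_poly_eq0 i) qp -size_poly_eq0 (eqp_size prs).
  by rewrite size_prod_XsubC.
have [m [m0 my mmin]] : exists m, [/\ m != 0, root (map_poly i m) y
    & forall p, root (map_poly i p) y -> m %| p].
  by apply: (minimal_annihilator q0); rewrite qp.
have [|mk mrs] := @dvdp_prod_XsubC _ _ rs id (map_poly i m).
  by rewrite -(eqp_dvdr _ prs) -qp dvdp_map mmin // qp.
have root_m z : root (map_poly i m) z = (z \in mask mk rs).
  by rewrite (eqp_root mrs) root_prod_XsubC.
have [z mz zy] : exists2 z, root (map_poly i m) z & z != y.
  apply: contrapT => noz; apply: nEy.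
  have sm : size m = 2.
    rewrite -(size_map_poly i) (eqp_size mrs) size_prod_XsubC; congr _.+1.
    have : {subset mask mk rs <= [:: y]}.
      move=> z; rewrite -root_m inE => mz; apply: contrapT => /negP zy.
      by apply: noz; exists z.
    move/(uniq_leq_size (mask_uniq urs mk)); rewrite /=.
    by move: my; rewrite root_m; case: (mask mk rs) => [|? []].
  rewrite Ei.
    have m1 : m`_1 != 0 by move: m0; rewrite -lead_coef_eq0 lead_coefE sm.
    have im1 : i m`_1 != 0 by rewrite fmorph_eq0.
    exists (- (m`_0 / m`_1)) => //; rewrite rmorphN fmorph_div.
    apply: (mulIf im1); rewrite mulNr divfK //; apply/esym/eqP.
    rewrite -addr_eq0 addrC mulrC.
    move/rootP: my; rewrite horner_coef size_map_poly sm !big_ord_recl big_ord0.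
    by rewrite !coef_map /= expr0 expr1 mulr1 addr0 => ->.
have hA := simple_extension m0 my mmin mz.
have EA e : E e -> range (fun p => ((map_poly i p).[y], (map_poly i p).[z])) (e, e).
  by move=> /iE[l [il _]]; exists l%:P => //; rewrite map_polyC !hornerC /= il.
have [g [gB gM gA]] := extend_to_endo hA EA.
exists g; split=> //; first by move=> e /EA/gA.
rewrite (gA y z); first exact/eqP.
by exists 'X => //; rewrite map_polyX !hornerX.
Qed.

End Extension.

(** * Finiteness from ultrafilters and compactness *)

Lemma ultra_finite_range (T : Type) (V : eqType) (U : set_system T)
    (phi : T -> V) (rs : seq V) : UltraFilter U ->
  U [set t | phi t \in rs] -> exists v, U [set t | phi t = v].
Proof.
move=> hU; elim: rs => [|v rs IH] Urs.
  by have [t] := filter_ex Urs; rewrite /= in_nil.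
have [|Unv] := in_ultra_setVsetC [set t | phi t = v] hU; first by exists v.
apply: IH; apply: filterS (filterI Urs Unv) => t /= [].
by rewrite inE => /predU1P[].
Qed.

Lemma compact_locally_constant (T : topologicalType) (V : choiceType)
    (C : set T) (phi : T -> V) : compact C ->
  (forall s, nbhs s [set t | phi t = phi s]) ->
  exists rs : seq V, uniq rs /\
    (forall v, v \in rs <-> exists2 t, C t & phi t = v).
Proof.
move=> /compact_near_coveringP cC phiC.
(* The filter of properties of all large enough lists: near-covering compactness then gives one list
   containing every value of [phi] on [C], to be filtered down to the values attained. *)
pose F (A : set (seq V)) := exists r0 : seq V,
  forall r, {subset r0 <= r} -> A r.
have FF : Filter F.
  split; first by exists [::].
    move=> A1 A2 [r1 A1r] [r2 A2r]; exists (r1 ++ r2) => r r12.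
    by split; [apply: A1r|apply: A2r] => v vr; apply: r12;
      rewrite mem_cat vr ?orbT.
  by move=> A1 A2 A12 [r A1r]; exists r => r' /A1r/A12.
have [s _|r0 /(_ r0) r0P] := cC (seq V) F (fun r t => phi t \in r) FF.
  exists ([set t | phi t = phi s], [set r : seq V | phi s \in r]) => /=.
    by split; [exact: phiC|exists [:: phi s] => r; apply; exact: mem_head].
  by move=> [t r] /= [-> ].
exists (undup [seq v <- r0 | `[< exists2 t, C t & phi t = v >]]).
split=> [|v]; first exact: undup_uniq.
rewrite mem_undup mem_filter; split=> [/andP[/asboolP]//|[t Ct tv]].
rewrite -tv; apply/andP; split; last exact: r0P.
by apply/asboolP; exists t.
Qed.

(** By injectivity [f] permutes [rs], hence only reorders the factors. *)
Lemma map_poly_prod_XsubC_stable (R : comNzRingType) (f : {rmorphism R -> R})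
    (rs : seq R) : injective f -> uniq rs -> {in rs, forall v, f v \in rs} ->
  map_poly f (\prod_(v <- rs) ('X - v%:P)) = \prod_(v <- rs) ('X - v%:P).
Proof.
move=> inj_f urs frs; have ufrs : uniq (map f rs) by rewrite map_inj_uniq.
have sub : {subset map f rs <= rs} by move=> _ /mapP[v /frs + ->].
have [_ eqrs] := uniq_min_size ufrs sub (eq_leq (esym (size_map _ _))).
rewrite -[RHS](perm_big _ (uniq_perm ufrs urs eqrs)) /= big_map rmorph_prod.
by apply: eq_bigr => v _; rewrite rmorphB /= map_polyX map_polyC.
Qed.

(** * The Galois correspondence *)

Section Galois.
Variables (F : fieldType) (n : nat) (K : sepClosure (ratfun F n)).
Implicit Types (E : set K) (C : set (baut K)) (s t : baut K).

Lemma endo_baut E (g : K -> K) : Int K E -> zmod_morphism g ->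
  monoid_morphism g -> (forall e, E e -> g e = e) ->
  exists2 s : baut K, Aut_over E s & s =1 g.
Proof.
move=> [_ bE sE] gB gM gE.
pose g' : {rmorphism K -> K} := HB.pack g
  (GRing.isZmodMorphism.Build _ _ g gB) (GRing.isMonoidMorphism.Build _ _ g gM).
have g_base : is_base_aut g.
  split=> //; first exact: (endo_bijective sE (@sepC_closed _ K) (g := g')).
  by move=> a; apply/gE/bE; exists a.
by exists (BAut g_base).
Qed.

Lemma fixed_field_subfield C : is_subfield (fixed_field C).
Proof.
split=> [|x y|x y]; rewrite !inE.
- by move=> c _; rewrite rmorph1.
- by move=> hx hy c Cc; rewrite rmorphB /= (hx c Cc) (hy c Cc).
- by move=> hx hy c Cc; rewrite fmorph_div /= (hx c Cc) (hy c Cc).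
Qed.

Lemma base_fixed C : @base_field F n K `<=` fixed_field C.
Proof. by move=> _ [a _ <-] c _; rewrite baut_base. Qed.

(** Reduces membership in a basic neighborhood of 1 to finitely many evaluations: the elements fixed
    by [s] form a subfield. *)
Lemma Aut_over_gen s (ys : seq K) : (forall y, y \in ys -> s y = y) ->
  Aut_over (subfield_gen (@base_field F n K `|` [set` ys])) s.
Proof.
move=> sys y yE; suff : fixed_field [set s] y by apply.
apply: yE; split; first exact: fixed_field_subfield.
by move=> z [/base_fixed|zys _ ->]; [apply|apply: sys].
Qed.

Lemma Int_fin_gen_mem (y : K) : exists E, [/\ Int K E, fin_gen E & E y].
Proof.
have [E [[_ bE sE] [ys Eys]]] := @Int_fin_gen_ex F n K.
exists (subfield_gen (@base_field F n K `|` [set` y :: ys])); split.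
- have bE' := @sub_gen_smallest _ (@is_subfield K) (@base_field F n K `|` [set` y :: ys]).
  split; first exact: subfield_gen_subfield.
    by apply: subset_trans bE' => z; left.
  apply: (separable_underS _ _ sE); first exact: subfield_gen_subfield.
  rewrite Eys; apply: smallest_sub; first exact: subfield_gen_subfield.
  apply: subset_trans bE' => z [bz|zys]; [by left|right].
  by rewrite /= inE zys orbT.
- by exists (y :: ys).
- by apply: sub_gen_smallest; right; rewrite /= mem_head.
Qed.

Lemma nbhs_eval s y : nbhs s [set t : baut K | t y = s y].
Proof.
have [E [IE fE Ey]] := Int_fin_gen_mem y; apply/nbhs_bautE.
by exists E; split=> // _ [t tE <-] /=; rewrite tE.
Qed.

Lemma filter_eval_seq (U : set_system (baut K)) (g : K -> K) (ys : seq K) :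
  Filter U -> (forall y, U [set t : baut K | t y = g y]) ->
  U [set t : baut K | forall y, y \in ys -> t y = g y].
Proof.
move=> FU Ug; elim: ys => [|y ys IH]; first exact: filterE.
apply: filterS (filterI (Ug y) IH) => t [ty tys] z.
by rewrite inE => /predU1P[->|/tys].
Qed.

Lemma compact_Aut_over E : Int K E -> compact (Aut_over E).
Proof.
move=> IE; have [_ _ sE] := IE; rewrite compact_ultra => U hU UE.
have /choice[g Ug] : forall y, exists v, U [set t : baut K | t y = v].
  move=> y; have [p [rs [pE _ py prs]]] := conjugates sE (@sepC_closed _ K) y.
  apply: (ultra_finite_range (rs := rs)); apply: filterS UE => t tE /=.
  have root_prs z : root p z = (z \in rs).
    by rewrite (eqp_root prs) root_prod_XsubC.
  have tp : map_poly t p = p by apply: map_poly_fixed pE.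
  by rewrite -root_prs -tp fmorph_root.
(* The pointwise limit [g] agrees on each finite list with some automorphism over [E], so it
   inherits every identity involving finitely many elements. *)
have evg (ys : seq K) : exists2 t, Aut_over E t & forall y, y \in ys -> t y = g y.
  have := filter_ex (filterI UE (filter_eval_seq ys _ Ug)).
  by case=> t []; exists t.
have [||e Ee|s sE' sg] := @endo_baut E g IE.
- move=> x y; have [t _ tg] := evg [:: x; y; x - y].
  by rewrite -!tg ?rmorphB // !inE eqxx ?orbT.
- split; first by have [t _ tg] := evg [:: 1]; rewrite -tg ?rmorph1 ?inE.
  move=> x y; have [t _ tg] := evg [:: x; y; x * y].
  by rewrite -!tg ?rmorphM // !inE eqxx ?orbT.
- by have [t tE tg] := evg [:: e]; rewrite -tg ?tE // inE.
(* Agreeing with [s] on the generators [ys] suffices to lie in [W], and this holds on a set of the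
   ultrafilter. *)
exists s; split=> // W /nbhs_bautE[E' [IE' [ys ->] sW]].
apply: filterS (filter_eval_seq ys _ Ug) => t tg; apply: sW.
exists (s^-1 * t)%g; last by rewrite mulVKg.
by apply: Aut_over_gen => y yys; rewrite bautME tg // -sg bautKV.
Qed.

Lemma hausdorff_baut : hausdorff_space (baut K).
Proof.
move=> s t st; apply: baut_inj => y.
have [u [us ut]] := st _ _ (nbhs_eval s y) (nbhs_eval t y).
by rewrite -us -ut.
Qed.

(** The orbit is finite by compactness, and products in [C] keep it stable. The ring [V] is [K] for
    single elements and [{poly K}] for tuples. *)
Lemma orbit_poly_stable (V : comNzRingType)
    (act : baut K -> {rmorphism V -> V}) C (u : V) :
  (forall s t v, act (s * t)%g v = act s (act t v)) ->
  (forall s, injective (act s)) ->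
  (forall s, nbhs s [set t | act t u = act s u]) -> Com K C ->
  exists rs : seq V, [/\ uniq rs,
      forall v, v \in rs <-> exists2 c, C c & act c u = v
    & forall c, C c -> map_poly (act c) (\prod_(v <- rs) ('X - v%:P)) =
        \prod_(v <- rs) ('X - v%:P)].
Proof.
move=> actM act_inj act_cst [gC cC].
have [rs [urs rsP]] := compact_locally_constant cC act_cst.
exists rs; split=> // c Cc; apply: map_poly_prod_XsubC_stable => // _ /rsP[t Ct <-].
apply/rsP; exists (c * t)%g => //; apply: set_mem.
by apply: (group_closedM gC); apply: mem_set.
Qed.

Lemma fixed_field_Int C : Com K C -> Int K (fixed_field C).
Proof.
move=> hC; have hE := fixed_field_subfield C.
split=> //; first exact: base_fixed.
move=> y; have [||rs [urs rsP Cfix]] :=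
  @orbit_poly_stable K (fun s => s) C y _ _ (nbhs_eval^~ y) hC => //.
  by move=> s; exact: fmorph_inj.
apply: separable_algebraic_eltP => //; exists (\prod_(v <- rs) ('X - v%:P)).
split; first by rewrite separable_prod_XsubC.
  apply/(all_nthP 0) => k _; apply/mem_set => c Cc.
  by rewrite -{2}(Cfix c Cc) coef_map.
rewrite root_prod_XsubC; apply/rsP; exists 1%g => //.
by apply: set_mem; case: hC => -[].
Qed.

(* The polynomial u encodes the tuple of its coefficients, so that tuples have
   an orbit polynomial too, with coefficients in K[T]. *)
Lemma Aut_over_fixed_poly C s (u : {poly K}) : Com K C ->
  Aut_over (fixed_field C) s -> exists2 c, C c & map_poly c u = map_poly s u.
Proof.
move=> hC sC; pose act t : {rmorphism {poly K} -> {poly K}} := map_poly t.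
have [|||rs [_ rsP Cfix]] := @orbit_poly_stable {poly K} act C u _ _ _ hC.
- by move=> s1 t v; apply/polyP => k; rewrite !coef_map.
- by move=> t; exact: map_poly_inj.
- move=> t.
  apply: filterS (filter_eval_seq (polyseq u) _ (nbhs_eval t)) => t' tt'.
  apply/polyP => k; rewrite !coef_map.
  have [ku|ku] := ltnP k (size u); first by apply: tt'; apply: mem_nth.
  by rewrite nth_default // !raddf0.
(* As [{poly K}] is a domain, lying in the orbit means being a root of the orbit polynomial; [s]
   fixes this polynomial, hence carries its root [u] to a root. *)
apply/rsP; rewrite -root_prod_XsubC.
have <- : map_poly (act s) (\prod_(v <- rs) ('X - v%:P)) =
    \prod_(v <- rs) ('X - v%:P).
  apply/polyP => k; rewrite coef_map; apply/polyP => l; rewrite coef_map /=.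
  apply: sC => c Cc; have /(congr1 (fun P : {poly {poly K}} => P`_k`_l)) := Cfix c Cc.
  by rewrite coef_map coef_map.
have urs : u \in rs.
  apply/rsP; exists 1%g; first by apply: set_mem; case: hC => -[].
  by apply/polyP => k; rewrite coef_map.
apply/rootP; rewrite -[map_poly s u]/(act s u) horner_map.
by move: urs; rewrite -root_prod_XsubC => /rootP->; rewrite rmorph0.
Qed.

(** [C] is closed, being compact in a Hausdorff space, and [Aut_over_fixed_poly] puts an element of
    [C] in each basic neighborhood of [s]. *)
Lemma Aut_over_fixed C : Com K C -> Aut_over (fixed_field C) = C.
Proof.
move=> hC; apply/seteqP; split=> [s sC|c Cc y]; last by apply.
apply: (compact_closed hausdorff_baut hC.2) => W.
move=> /nbhs_bautE[E [_ [ys ->] sW]].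
(* [Poly] may drop trailing zeros of [ys], but the coefficients read with default 0 are still its
   entries. *)
have [c Cc cs] := Aut_over_fixed_poly (Poly ys) hC sC.
exists c; split=> //; apply: sW; exists (s^-1 * c)%g; last by rewrite mulVKg.
apply: Aut_over_gen => _ /(nthP 0)[k ky <-].
have /(congr1 (fun p : {poly K} => p`_k)) := cs.
by rewrite !coef_map coef_Poly bautME /= => ->; rewrite bautKV.
Qed.

Lemma fixed_Aut_over E : Int K E -> fixed_field (Aut_over E) = E.
Proof.
move=> IE; have [hE bE sE] := IE; apply/seteqP; split=> [y yA|y Ey s]; last exact.
apply: contrapT => nEy.
have [g [gB gM gE]] := exists_moving_endo sE (@sepC_closed _ K) hE nEy.
by have [s sA <-] := endo_baut IE gB gM gE; rewrite yA.
Qed.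

End Galois.

(** * Finite spans over a subfield *)

Section Span.
Variable K : fieldType.
Implicit Types (E M W : set K) (b w : seq K).

Fixpoint subfield_span E b : set K :=
  if b is x :: b' then
    [set u | exists a v, [/\ E a, subfield_span E b' v & u = a * x + v]]
  else [set 0].

Section SubfieldSpan.
Variables (E : set K) (hE : is_subfield E).

Lemma subfield_span0 b : subfield_span E b 0.
Proof.
elim: b => //= x b IH; exists 0, 0; rewrite mul0r addr0.
by split=> //; apply: subfield0.
Qed.

Lemma subfield_spanZB b a u v : E a -> subfield_span E b u ->
  subfield_span E b v -> subfield_span E b (u - a * v).
Proof.
move=> Ea; elim: b u v => [|x b IH] u v /=; first by move=> -> ->; rewrite mulr0 subr0.
move=> [c [u' [Ec bu' ->]]] [d [v' [Ed bv' ->]]].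
exists (c - a * d), (u' - a * v'); split.
- by apply: subfieldB => //; apply: subfieldM.
- exact: IH.
- by rewrite mulrDr mulrBl opprD addrACA mulrA.
Qed.

Lemma subfield_span_cat b b' u v :
  subfield_span E b u -> subfield_span E b' v ->
  subfield_span E (b ++ b') (u + v).
Proof.
elim: b u => [|x b IH] u /=; first by move=> -> ?; rewrite add0r.
move=> [a [u' [Ea bu' ->]]] b'v; exists a, (u' + v).
by split=> //; [exact: IH|rewrite addrA].
Qed.

Lemma subfield_span_mulr b u y :
  subfield_span E b u -> subfield_span E [seq x * y | x <- b] (u * y).
Proof.
elim: b u => [|x b IH] u /=; first by move=> ->; rewrite mul0r.
move=> [a [v [Ea bv ->]]]; exists a, (v * y).
by split=> //; [exact: IH|rewrite mulrDl mulrA].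
Qed.

(** Elimination along [b]: the induction covers the part of [W] in the span of the tail. If some u
    in [W] has a nonzero coefficient at the head, multiples of u clear that coefficient in all other
    vectors of [W]. *)
Lemma subspace_span b W : W `<=` subfield_span E b ->
  (forall a u v, E a -> W u -> W v -> W (u - a * v)) ->
  exists2 w, [set` w] `<=` W & W `<=` subfield_span E w.
Proof.
elim: b W => [|x b IH] W Wb WB; first by exists [::].
have [|a u v Ea [Wu bu] [Wv bv]|w wW Ww] := IH (W `&` subfield_span E b).
- by move=> u [].
- by split; [exact: WB|exact: subfield_spanZB].
have [[u [a [v [Wu Ea bv uE a0]]]]|noW] := pselect
    (exists u a v, [/\ W u, E a, subfield_span E b v, u = a * x + v & a != 0]).
  exists (u :: w) => [z|z Wz].
    by rewrite /= inE => /predU1P[->|/wW[]].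
  have [c [z' [Ec bz' zE]]] := Wb _ Wz.
  have Eca : E (c / a) by apply: subfield_div.
  exists (c / a), (z - c / a * u); split=> //; last by rewrite addrC subrK.
  apply: Ww; split; first exact: WB.
  rewrite zE uE mulrDr mulrA divfK // opprD addrACA subrr add0r.
  exact: subfield_spanZB.
exists w => [z /wW[]//|u Wu]; apply: Ww; split=> //.
have [a [v [Ea bv uE]]] := Wb _ Wu; rewrite uE.
have [->|a0] := eqVneq a 0; first by rewrite mul0r add0r.
by case: noW; exists u, a, v.
Qed.

Lemma simple_extension_span M b y (p : {poly K}) : is_subfield M ->
  M `<=` subfield_span E b -> p \is a polyOver (mem M) -> p != 0 -> root p y ->
  exists M' b', [/\ is_subfield M', M `<=` M', M' y & M' `<=` subfield_span E b'].
Proof.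
move=> hM Mb pM p0 py.
have [L [i Mi]] := subfield_range hM.
have iM e : M e -> exists l, i l = e /\ i l = e.
  by rewrite Mi => -[l _ il]; exists l.
have [q [qp _]] := polyOver_lift iM pM.
have q0 : q != 0 by rewrite -(map_poly_eq0 i) qp.
have [|m [m0 my mmin]] := minimal_annihilator (i := i) (x := y) q0; first by rewrite qp.
(* Taking the same embedding and the same root twice shows that the values of polynomials at y are
   closed under inverses. *)
have [_ _ _ AV _] := simple_extension m0 my mmin my.
(* Horner's scheme: raising the degree bound multiplies the spanning list by y and appends [b] for
   the constant term. *)
have trunc d : exists b', forall p : {poly L}, (size p <= d)%N ->
    subfield_span E b' (map_poly i p).[y].
  elim: d => [|d [b' IH]].
    exists [::] => r; rewrite leqn0 size_poly_eq0 => /eqP->.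
    by rewrite rmorph0 horner0.
  exists ([seq x * y | x <- b'] ++ b) => r.
  elim/poly_ind: r => [_|r c _ sr].
    by rewrite rmorph0 horner0; apply: subfield_span0.
  rewrite rmorphD rmorphM /= map_polyX map_polyC hornerMXaddC.
  apply: subfield_span_cat; last by apply: Mb; rewrite Mi; exists c.
  apply: subfield_span_mulr; apply: IH; move: sr; rewrite size_MXaddC.
  by case: ifP => // /andP[/eqP-> _]; rewrite size_poly0.
have [b' b'P] := trunc (size m).
exists (range (fun p => (map_poly i p).[y])), b'; split.
- split=> [|u v|u v]; rewrite !inE.
  + by exists 1 => //; rewrite rmorph1 hornerC.
  + move=> [r _ <-] [r' _ <-]; exists (r - r') => //.
    by rewrite rmorphB hornerD hornerN.
  + move=> [r _ <-] [r' _ <-].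
    have [|r'' _ [r''V _]] := AV ((map_poly i r').[y], (map_poly i r').[y]).
      by exists r'.
    by exists (r * r'') => //; rewrite rmorphM hornerM r''V.
- by move=> e /iM[l [il _]]; exists l%:P => //; rewrite map_polyC hornerC.
- by exists 'X => //; rewrite map_polyX hornerX.
- move=> _ [r _ <-]; rewrite (divp_eq r m) rmorphD rmorphM hornerD hornerM.
  rewrite (rootP my) mulr0 add0r; apply: b'P.
  by apply: ltnW; rewrite ltn_modp.
Qed.

Lemma algebraic_extension_span (ys : seq K) :
  (forall y, y \in ys ->
    exists p, [/\ p \is a polyOver (mem E), p != 0 & root p y]) ->
  exists M b, [/\ is_subfield M, E `<=` M, [set` ys] `<=` M
    & M `<=` subfield_span E b].
Proof.
elim: ys => [_|y ys IH alg].
  exists E, [:: 1]; split=> // u Eu; exists u, 0.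
  by rewrite mulr1 addr0.
have [z zys|M [b [hM EM ysM Mb]]] := IH; first by apply: alg; rewrite inE zys orbT.
have [p [pE p0 py]] := alg y (mem_head _ _).
have pM : p \is a polyOver (mem M).
  by apply/allP => c /(allP pE); rewrite !inE; apply: EM.
have [M' [b' [hM' MM' M'y M'b']]] := simple_extension_span hM Mb pM p0 py.
exists M', b'; split=> //; first exact: subset_trans MM'.
by move=> z; rewrite /= inE => /predU1P[->//|/ysM/MM'].
Qed.

End SubfieldSpan.
End Span.

(** * Open subgroups and finite generation *)

Section OpenSubgroups.
Variables (F : fieldType) (n : nat) (K : sepClosure (ratfun F n)).
Implicit Types (E : set K).

Lemma fin_gen_sub E E' : Int K E -> fin_gen E' -> E `<=` E' -> fin_gen E.
Proof.
move=> [hE bE sE] [ys E'E] EE'.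
have /choice[p pP] : forall y, exists p : {poly K},
    [/\ p \is a polyOver (mem E), p != 0 & root p y].
  by move=> y; have [p [mp pE py _] _] := sE y; exists p; rewrite monic_neq0.
(* These coefficients lie in [E], and the generators [ys] of [E'] are algebraic over the field [E0]
   that they generate. *)
pose cs := flatten [seq polyseq (p y) | y <- ys].
pose E0 := subfield_gen (@base_field F n K `|` [set` cs]).
have bE0 : @base_field F n K `|` [set` cs] `<=` E0 by apply: sub_gen_smallest.
have hE0 : is_subfield E0 by apply: subfield_gen_subfield.
have csE : [set` cs] `<=` E.
  move=> c /flatten_mapP[y yys cp]; have [pE _ _] := pP y.
  by apply/set_mem/(allP pE).
have E0E : E0 `<=` E by apply: smallest_sub => [//|] c [/bE|/csE].
have [y yys|M [b [hM E0M ysM Mb]]] := @algebraic_extension_span _ _ hE0 ys.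
  have [pE p0 py] := pP y; exists (p y); split=> //.
  apply/allP => c cp; apply: mem_set; apply: bE0; right.
  by apply/flatten_mapP; exists y.
(* [E] is an [E0]-subspace of [E'], which lies in [M]; so finitely many elements [w] of [E] span it,
   and [cs ++ w] generates it. *)
have [|a u v E0a Eu Ev|w wE Ew] := @subspace_span _ _ hE0 b E.
- apply: subset_trans Mb; apply: subset_trans EE' _; rewrite E'E.
  apply: smallest_sub => [//|] y [by_|/ysM//].
  by apply: E0M; apply: bE0; left.
- by apply: subfieldB => //; apply: subfieldM => //; apply: E0E.
exists (cs ++ w); set E1 := subfield_gen _.
have bE1 : @base_field F n K `|` [set` cs ++ w] `<=` E1 by apply: sub_gen_smallest.
have hE1 : is_subfield E1 by apply: subfield_gen_subfield.
apply/seteqP; split; last first.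
  apply: smallest_sub => [//|] c [/bE//|]; rewrite /= mem_cat => /orP[/csE|/wE]//.
have E0E1 : E0 `<=` E1.
  apply: smallest_sub => [//|] c [bc|cc]; apply: bE1; [by left|right].
  by rewrite /= mem_cat cc.
have wE1 : [set` w] `<=` E1.
  by move=> c cw; apply: bE1; right; rewrite /= mem_cat cw orbT.
apply: subset_trans Ew _; elim: (w) wE1 => [_ _ ->|x w' IH wE1]; first exact: subfield0.
move=> _ /= [a [v [/E0E1 E1a wv ->]]]; apply: (subfieldD hE1) => //.
  by apply: (subfieldM hE1) => //; apply: (wE1 x); rewrite /= mem_head.
by apply: IH wv => c cw'; apply: (wE1 c); rewrite /= inE cw' orbT.
Qed.

(** Taking fixed fields turns an inclusion of a basic subgroup in [Aut_over E] into an inclusion of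
    [E] in a finitely generated field. Conversely [Aut_over E] is itself a basic subgroup. *)
Lemma open_Aut_over E : Int K E -> open (Aut_over E) <-> fin_gen E.
Proof.
move=> IE; split=> [oE|fE].
  have /nbhs1_bautE[E' [IE' fE' E'E]] : nbhs (1%g : baut K) (Aut_over E).
    by apply: open_nbhs_nbhs; split.
  apply: (fin_gen_sub IE fE'); rewrite -(fixed_Aut_over IE) -(fixed_Aut_over IE').
  by move=> y yE s /E'E; apply: yE.
rewrite openE => s sE; apply/nbhs_bautE; exists E; split=> // _ [t tE <-].
by move=> y Ey; rewrite bautME tE ?sE.
Qed.

End OpenSubgroups.

Theorem theorem6p7 (F : fieldType) (n : nat) (K : sepClosure (ratfun F n)) :
  [/\ (forall E : set K, Int K E -> Com K (Aut_over E)),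
      (forall C : set (baut K), Com K C -> Int K (fixed_field C)),
      (forall C : set (baut K), Com K C -> Aut_over (fixed_field C) = C),
      (forall E : set K, Int K E -> fixed_field (Aut_over E) = E)
    & (forall E : set K, Int K E ->
        (compact (Aut_over E) /\ open (Aut_over E)) <-> fin_gen E)].
Proof.
split.
- by move=> E IE; split; [exact: Aut_over_group|exact: compact_Aut_over].
- exact: fixed_field_Int.
- exact: Aut_over_fixed.
- exact: fixed_Aut_over.
- move=> E IE; rewrite -(open_Aut_over IE); split=> [[]//|oE].
  by split=> //; exact: compact_Aut_over.
Qed.
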